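(* Let $\Sigma$ be a set of equations in a finitary algebraic signature, and suppose that the free-algebra functor $F_\Sigma:\mathrm{Set}\to\mathrm{Set}$ weakly preserves kernel pairs. Then for any ternary terms $p,q$, the equation $$p(x,x,y)\approx q(x,y,y)$$ is a consequence of $\Sigma$ if and only if there exists a quaternary term $s$ such that the equations $$p(x,y,z)\approx s(x,y,z,z),\qquad q(x,y,z)\approx s(x,x,y,z)$$ are consequences of $\Sigma$.
   Context: For a set $X$, $F_\Sigma(X)$ is (the underlying set of) the free $\Sigma$-algebra over $X$: terms with variables from $X$, where $p,q$ are identified iff $p\approx q$ is a consequence of $\Sigma$. For $\varphi:X\to Y$, $F_\Sigma\varphi$ is variable substitution $p(x_1,\dots,x_n)\mapsto p(\varphi x_1,\dots,\varphi x_n)$. The axiom of choice is assumed. A functor $F:\mathrm{Set}\to\mathrm{Set}$ weakly preserves kernel pairs if for every map $f:A\to C$, with kernel pair (pullback of $f$ with itself) $(K,\pi_1,\pi_2)$, and all $u_1,u_2\in F(A)$ with $(Ff)u_1=(Ff)u_2$ there is $w\in F(K)$ with $(F\pi_1)w=u_1$ and $(F\pi_2)w=u_2$. Here $x,y,z$ are distinct variables. *)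

(* Defs.v *)
From mathcomp Require Import all_boot.
From mathcomp Require Import boolp classical_sets.

Set Implicit Arguments.
Unset Strict Implicit.
Unset Printing Implicit Defensive.

Local Open Scope classical_set_scope.

(** * Terms, algebras and equational consequence *)

Record signature := Signature { op :> Type; arity : op -> nat }.

(* Terms with variables from an arbitrary type [X]; in particular an [n]-ary
   term is an element of [term S 'I_n]. *)
Inductive term (S : signature) (X : Type) : Type :=
| Var of X
| App (o : S) of ('I_(arity o) -> term S X).
Arguments Var {S X}.
Arguments App {S X}.

Fixpoint rename (S : signature) (X Y : Type) (phi : X -> Y) (t : term S X) :
    term S Y :=
  match t with
  | Var x => Var (phi x)
  | App o ts => App o (fun i => rename phi (ts i))
  end.

(* [at_vars p [tuple x; y; z]] is the term p(x,y,z). *)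
Definition at_vars (S : signature) (n : nat) (X : Type) (p : term S 'I_n)
    (xs : n.-tuple X) : term S X :=
  rename (tnth xs) p.

Record algebra (S : signature) := Algebra {
  carrier :> Type;
  interp : forall o : S, ('I_(arity o) -> carrier) -> carrier
}.

Fixpoint eval (S : signature) (A : algebra S) (X : Type) (v : X -> A)
    (t : term S X) : A :=
  match t with
  | Var x => v x
  | App o ts => interp (fun i => eval v (ts i))
  end.

Definition satisfies (S : signature) (A : algebra S) (X : Type)
    (p q : term S X) : Prop :=
  forall v : X -> A, eval v p = eval v q.

(* Axioms are written over a fixed countable set of variables. *)
Definition equation (S : signature) : Type := (term S nat * term S nat)%type.

Definition models (S : signature) (A : algebra S) (Sigma : set (equation S)) :
    Prop :=
  forall e, Sigma e -> satisfies A e.1 e.2.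

Definition consequence (S : signature) (Sigma : set (equation S)) (X : Type)
    (p q : term S X) : Prop :=
  forall A : algebra S, models A Sigma -> satisfies A p q.

Section Consequence.
Variables (S : signature) (Sigma : set (equation S)).

Lemma consequence_refl X (p : term S X) : consequence Sigma p p.
Proof. by []. Qed.

Lemma consequence_sym X (p q : term S X) :
  consequence Sigma p q -> consequence Sigma q p.
Proof. by move=> pq A mA v; rewrite (pq A mA v). Qed.

Lemma consequence_trans X (p q r : term S X) :
  consequence Sigma p q -> consequence Sigma q r -> consequence Sigma p r.
Proof. by move=> pq qr A mA v; rewrite (pq A mA v) (qr A mA v). Qed.

Lemma eval_rename (A : algebra S) X Y (phi : X -> Y) (v : Y -> A)
    (t : term S X) :
  eval v (rename phi t) = eval (v \o phi) t.
Proof.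
elim: t => //= o ts IH; congr interp; apply/funext => i; exact: IH.
Qed.

Lemma consequence_rename X Y (phi : X -> Y) (p q : term S X) :
  consequence Sigma p q -> consequence Sigma (rename phi p) (rename phi q).
Proof. by move=> pq A mA v; rewrite !eval_rename; exact: pq. Qed.

Lemma rename_id X (t : term S X) : rename id t = t.
Proof.
elim: t => //= o ts IH; congr App; apply/funext => i; exact: IH.
Qed.

Lemma rename_comp X Y Z (psi : Y -> Z) (phi : X -> Y) (t : term S X) :
  rename (psi \o phi) t = rename psi (rename phi t).
Proof.
elim: t => //= o ts IH; congr App; apply/funext => i; exact: IH.
Qed.

End Consequence.

(** * Free algebras: terms modulo consequence *)

(* Elements of the quotient are the equivalence classes themselves. *)
Definition free_set (S : signature) (Sigma : set (equation S)) (X : Type) : Type :=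
  {C : set (term S X) | exists p, C = consequence Sigma p}.

Section Free.
Variables (S : signature) (Sigma : set (equation S)).

Definition free_class X (p : term S X) : free_set Sigma X :=
  exist _ (consequence Sigma p) (ex_intro _ p erefl).

Definition free_repr X (u : free_set Sigma X) : term S X := projT1 (cid (svalP u)).

Lemma free_reprK X (u : free_set Sigma X) : free_class (free_repr u) = u.
Proof.
by case: u => C PC; apply: eq_exist; rewrite /free_repr; case: cid.
Qed.

Lemma free_classP X (p q : term S X) :
  free_class p = free_class q <-> consequence Sigma p q.
Proof.
split=> [/(congr1 sval)/= pq|pq].
  by rewrite pq; exact: consequence_refl.
apply: eq_exist; apply/funext => r; apply/propext; split.
  exact/consequence_trans/consequence_sym.
exact: consequence_trans.
Qed.

(* The quotient algebra. Operations act on chosen representatives;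
   [free_interp_class] shows that the choice is irrelevant. *)
Definition free_algebra X : algebra S :=
  @Algebra S (free_set Sigma X)
    (fun o us => free_class (App o (fun i => free_repr (us i)))).

Lemma free_interp_class X (o : S) (ts : 'I_(arity o) -> term S X) :
  @interp S (free_algebra X) o (fun i => free_class (ts i)) =
  free_class (App o ts).
Proof.
apply/free_classP => A mA v /=; congr interp; apply/funext => i.
by have /free_classP := free_reprK (free_class (ts i)); apply.
Qed.

Lemma free_algebra_models X : models (free_algebra X) Sigma.
Proof.
move=> e Se v.
have evalE (t : term S nat) (A : algebra S) (w : X -> A) : models A Sigma ->
    eval w (free_repr (eval v t)) = eval (fun n => eval w (free_repr (v n))) t.
  move=> mA; elim: t => //= o ts IH.
  have /free_classP -> // := free_reprK
    (free_class (App o (fun i => free_repr (eval v (ts i))))).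
  by congr interp; apply/funext => i; exact: IH.
rewrite -[LHS]free_reprK -[RHS]free_reprK; apply/free_classP => A mA w.
by rewrite !evalE //; exact: mA.
Qed.

(* Substitution of variables, again on a representative; see
   [free_map_class]. *)
Definition free_map X Y (phi : X -> Y) (u : free_set Sigma X) : free_set Sigma Y :=
  free_class (rename phi (free_repr u)).

Lemma free_map_class X Y (phi : X -> Y) (p : term S X) :
  free_map phi (free_class p) = free_class (rename phi p).
Proof.
apply/free_classP/consequence_rename.
exact/free_classP/free_reprK.
Qed.

Lemma free_map_id X (u : free_set Sigma X) : free_map id u = u.
Proof. by rewrite /free_map rename_id free_reprK. Qed.

Lemma free_map_comp X Y Z (psi : Y -> Z) (phi : X -> Y) (u : free_set Sigma X) :
  free_map (psi \o phi) u = free_map psi (free_map phi u).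
Proof. by rewrite [free_map phi u]/free_map free_map_class -rename_comp. Qed.

End Free.

(** * Set functors and weak preservation of kernel pairs *)

Record set_functor := SetFunctor {
  fobj :> Type -> Type;
  fmap : forall X Y : Type, (X -> Y) -> fobj X -> fobj Y;
  fmap_id : forall (X : Type) (u : fobj X), fmap id u = u;
  fmap_comp : forall (X Y Z : Type) (g : Y -> Z) (f : X -> Y) (u : fobj X),
    fmap (g \o f) u = fmap g (fmap f u)
}.
Arguments fmap F {X Y} f u : rename.

Definition free_functor (S : signature) (Sigma : set (equation S)) :
    set_functor :=
  @SetFunctor (fun X => free_algebra Sigma X) (@free_map S Sigma)
    (@free_map_id S Sigma) (@free_map_comp S Sigma).

Definition kernel_pair (A C : Type) (f : A -> C) : Type :=
  {a : A * A | f a.1 = f a.2}.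

Definition kp1 (A C : Type) (f : A -> C) (k : kernel_pair f) : A := (sval k).1.
Definition kp2 (A C : Type) (f : A -> C) (k : kernel_pair f) : A := (sval k).2.

Definition weakly_preserves_kernel_pairs (F : set_functor) : Prop :=
  forall (A C : Type) (f : A -> C) (u1 u2 : F A),
    fmap F f u1 = fmap F f u2 ->
    exists w : F (kernel_pair f),
      fmap F (@kp1 A C f) w = u1 /\ fmap F (@kp2 A C f) w = u2.

(* Main.v *)
(** Let f identify 0 with 1 and 2 with 3 in the variable set 'I_4. The terms
    p(0,1,2) and q(0,2,3) have the same image under f, so a term t in variables
    from the kernel pair of f projects onto both. Retracting 3 to 2 fixes
    p(0,1,2), and retracting 1 to 0 fixes q(0,2,3); applied to the first and
    second components, they leave only the four pairs (0,0), (1,0), (2,2),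
    (2,3), which become the four variables of s. *)

Require Import Defs.
From mathcomp Require Import all_boot.
From mathcomp Require Import boolp classical_sets.

Lemma rename_at_vars {S : signature} {n : nat} {X Y : Type} (phi : X -> Y)
    (p : term S 'I_n) (xs : n.-tuple X) :
  rename phi (at_vars p xs) = at_vars p (map_tuple phi xs).
Proof.
rewrite /at_vars -rename_comp; congr rename.
by apply/funext => i /=; rewrite tnth_map.
Qed.

(** The substituted tuples enter through equations between sequences, so each use only has to
    compute [map phi]. *)
Lemma consequence_at_vars {S : signature} {Sigma : set (equation S)}
    {m n : nat} {X Y : Type} (phi : X -> Y) {p : term S 'I_m} {q : term S 'I_n}
    {xs : m.-tuple X} {ys : n.-tuple X} {xs' : m.-tuple Y} {ys' : n.-tuple Y} :
  map phi xs = xs' -> map phi ys = ys' ->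
  consequence Sigma (at_vars p xs) (at_vars q ys) ->
  consequence Sigma (at_vars p xs') (at_vars q ys').
Proof.
move=> xsE ysE /(@consequence_rename _ _ _ _ phi).
rewrite !rename_at_vars.
have -> : map_tuple phi xs = xs' by exact: val_inj.
by have -> : map_tuple phi ys = ys' by exact: val_inj.
Qed.

(** Weak preservation transferred from classes to terms: any representative of the lifted class
    serves as [t]. *)
Lemma free_kernel_pair_lift {S : signature} {Sigma : set (equation S)}
    (wpk : weakly_preserves_kernel_pairs (free_functor Sigma))
    {X Y : Type} (f : X -> Y) {p q : term S X} :
  consequence Sigma (rename f p) (rename f q) ->
  exists t : term S (kernel_pair f),
    consequence Sigma p (rename (@kp1 _ _ f) t) /\
    consequence Sigma q (rename (@kp2 _ _ f) t).
Proof.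
move=> fpq.
have [|w [w1 w2]] := wpk _ _ f (free_class Sigma p) (free_class Sigma q).
  by rewrite /= !free_map_class; apply/free_classP.
by exists (free_repr w); split; apply/free_classP; [rewrite -w1 | rewrite -w2].
Qed.

Theorem lemma9 (S : signature) (Sigma : set (equation S))
    (wpk : weakly_preserves_kernel_pairs (free_functor Sigma))
    (x y z : nat) (xyz : uniq [:: x; y; z]) (p q : term S 'I_3) :
  consequence Sigma (at_vars p [tuple x; x; y]) (at_vars q [tuple x; y; y]) <->
  exists s : term S 'I_4,
    consequence Sigma (at_vars p [tuple x; y; z]) (at_vars s [tuple x; y; z; z]) /\
    consequence Sigma (at_vars q [tuple x; y; z]) (at_vars s [tuple x; x; y; z]).
Proof.
have [xy xz yz] : [/\ x == y = false, x == z = false & y == z = false].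
  move: xyz; rewrite /= !inE negb_or.
  by case/andP => /andP[/negPf-> /negPf->] /andP[/negPf->].
split=> [pq|[s [ps qs]]].
- pose i0 : 'I_4 := inord 0; pose i1 : 'I_4 := inord 1.
  pose i2 : 'I_4 := inord 2; pose i3 : 'I_4 := inord 3.
  pose f (i : 'I_4) := i < 2.
  have [|t [pt qt]] := free_kernel_pair_lift wpk f
    (p := at_vars p [tuple i0; i1; i2]) (q := at_vars q [tuple i0; i2; i3]).
    rewrite !rename_at_vars.
    (* Sending [x] to [true] and [y] to [false] turns the hypothesis into the equality of the images
       under [f]. *)
    by apply: (consequence_at_vars (eq_op^~ x)) pq;
      rewrite /= /f !inordK // eqxx (eq_sym y) xy.
  (* Numbers the pairs (0,0), (1,0), (2,2), (2,3) as 0, 1, 2, 3: the first component decides within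
     {0,1}, the second within {2,3}. *)
  pose pair_var (k : kernel_pair f) := if f (kp1 k) then kp1 k else kp2 k.
  have kpP (k : kernel_pair f) : f (kp1 k) = f (kp2 k) := svalP k.
  exists (rename pair_var t); split.
  + have := consequence_rename (tnth [tuple x; y; z; z]) pt.
    rewrite rename_at_vars -rename_comp /at_vars -rename_comp.
    have -> : map_tuple (tnth [tuple x; y; z; z]) [tuple i0; i1; i2] =
              [tuple x; y; z].
      by apply: val_inj; rewrite /= !(tnth_nth 0) !inordK.
    (* On {0,1} [pair_var] is [kp1]; on {2,3} every index is sent to [z]. *)
    congr consequence; congr rename; apply/funext => k /=.
    rewrite /pair_var; move: (kpP k).
    by case: (kp1 k) (kp2 k) => [[|[|[|[|i]]]] ?] [[|[|[|[|j]]]] ?].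
  + have := consequence_rename (tnth [tuple x; x; y; z]) qt.
    rewrite rename_at_vars -rename_comp /at_vars -rename_comp.
    have -> : map_tuple (tnth [tuple x; x; y; z]) [tuple i0; i2; i3] =
              [tuple x; y; z].
      by apply: val_inj; rewrite /= !(tnth_nth 0) !inordK.
    (* Dually, {0,1} collapses to [x], and on {2,3} [pair_var] is [kp2]. *)
    congr consequence; congr rename; apply/funext => k /=.
    rewrite /pair_var; move: (kpP k).
    by case: (kp1 k) (kp2 k) => [[|[|[|[|i]]]] ?] [[|[|[|[|j]]]] ?].
(* Both sides equal s(x,x,y,y): put x, x, y for x, y, z in the equation for [p], and x, y, y in the
   one for [q]. *)
- apply: (consequence_trans (q := at_vars s [tuple x; x; y; y])).
    by apply: (consequence_at_vars (fun n => if n == z then y else x)) ps;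
      rewrite /= eqxx xz yz.
  apply: consequence_sym.
  by apply: (consequence_at_vars (fun n => if n == x then x else y)) qs;
    rewrite /= eqxx (eq_sym y) xy (eq_sym z) xz.
Qed.
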